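(* For every finite simple graph $G$, at least one of the following holds: (1) $\chi(G)\le\frac{\omega(G)+\Delta(G)+1}{2}$; (2) $\chi(G)\le\frac{\frac{\omega(G)}{2}+|G|-\alpha(G)}{2}+1$.
   Context: $\chi(G)$, $\omega(G)$, $\Delta(G)$, $\alpha(G)$ and $|G|$ denote the chromatic number, clique number, maximum degree, independence number and number of vertices of $G$. *)

(* Defs.v *)
From mathcomp Require Import all_boot all_order all_algebra.

Set Implicit Arguments.
Unset Strict Implicit.
Unset Printing Implicit Defensive.

Record sgraph := SGraph {
  vertex :> finType;
  adj : rel vertex;
  adj_sym : symmetric adj;
  adj_irr : irreflexive adj
}.

Section Invariants.

Variable G : sgraph.

Definition clique (A : {set G}) : bool :=
  [forall x in A, forall y in A, (x != y) ==> adj x y].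

Definition independent (A : {set G}) : bool :=
  [forall x in A, forall y in A, ~~ adj x y].

Definition clique_number : nat := \max_(A : {set G} | clique A) #|A|.

Definition independence_number : nat :=
  \max_(A : {set G} | independent A) #|A|.

Definition degree (x : G) : nat := #|[set y | adj x y]|.

Definition max_degree : nat := \max_(x : G) degree x.

Definition proper_coloring (k : nat) (f : {ffun G -> 'I_k}) : bool :=
  [forall x, forall y, adj x y ==> (f x != f y)].

Definition colorable (k : nat) : bool :=
  [exists f : {ffun G -> 'I_k}, proper_coloring f].

Lemma ex_colorable : exists k, colorable k.
Proof.
exists #|G|; apply/existsP; exists [ffun x => enum_rank x].
apply/forallP=> x; apply/forallP=> y; apply/implyP=> xy.
rewrite !ffunE (inj_eq enum_rank_inj).
by apply: contraTneq xy => ->; rewrite adj_irr.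
Qed.

Definition chromatic_number : nat := ex_minn ex_colorable.

End Invariants.

(* Main.v *)
(** Let I be a maximum independent set and K a vertex-critical subset of its
    complement with the same chromatic number, so that chi(G) <= chi(K) + 1.
    Among the optimal colorings of K take one with the fewest singleton classes;
    the set Q of these singletons is a clique and 2 chi(K) <= |K| + |Q|.  An
    exchange argument shows that no vertex of K has two nonneighbors in Q.
    If every u in Q has a nonneighbor w in K, then w lies in a class {w, z} of
    size two, and Q together with all these z is a clique of size 2|Q|, which
    gives (2).  Otherwise some u in Q is adjacent to all of K and to a vertex of
    I, so Delta >= |K|, and (1) follows unless |Q| = omega.  In that case K is
    a maximum clique; unless (1) or (2) holds for counting reasons, every vertex
    of K has exactly one neighbor outside K, and an omega-coloring of G can be
    written down. *)

Require Import Defs.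
From mathcomp Require Import all_boot all_order all_algebra.
From mathcomp Require Import zify lra.
Import Order.TTheory GRing.Theory Num.Theory.

Set Implicit Arguments.
Unset Strict Implicit.
Unset Printing Implicit Defensive.

Section PartialColorings.

Variable G : sgraph.
Implicit Types (S : {set G}) (f g : {ffun G -> G}) (x y z u v w : G).

(** * Proper colorings of vertex subsets *)

Definition proper_on (T : eqType) S (f : G -> T) :=
  [forall x in S, forall y in S, adj x y ==> (f x != f y)].

Lemma proper_onP (T : eqType) S (f : G -> T) :
  reflect {in S &, forall x y, adj x y -> f x <> f y} (proper_on S f).
Proof.
apply: (iffP forall_inP) => [h x y xS yS xy | h x xS].
  by move/forall_inP: (h x xS) => /(_ y yS) /implyP /(_ xy) /eqP.
by apply/forall_inP => y yS; apply/implyP => xy; apply/eqP/h.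
Qed.

Lemma chromatic_number_le (T : finType) (f : G -> T) :
  proper_on [set: G] f -> chromatic_number G <= #|f @: [set: G]|.
Proof.
move=> /proper_onP fP; rewrite /chromatic_number.
case: ex_minnP => m _; apply.
have mem x : f x \in f @: [set: G] by rewrite imset_f.
apply/existsP; exists [ffun x => enum_rank_in (mem x) (f x)].
apply/forallP => x; apply/forallP => y; apply/implyP => xy; rewrite !ffunE.
apply/eqP => e; apply: (fP x y) => //.
have := congr1 enum_val e; rewrite enum_rankK_in // => ->.
by rewrite enum_rankK_in.
Qed.

Definition id_coloring : {ffun G -> G} := [ffun x => x].

Lemma id_coloring_proper S : proper_on S id_coloring.
Proof.
by apply/proper_onP=> x y _ _; rewrite !ffunE => /[swap] ->; rewrite adj_irr.
Qed.

(** The chromatic number of the subgraph induced on [S]. The vertex set itself serves as palette,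
    which is always large enough; only colors used on [S] count, so the values outside [S] are
    arbitrary. *)
Definition chi S : nat :=
  #|[arg min_(f < id_coloring | proper_on S f) #|f @: S|] @: S|.

Lemma chi_le S f : proper_on S f -> chi S <= #|f @: S|.
Proof.
by rewrite /chi; case: arg_minnP => [|g _]; [apply: id_coloring_proper | apply].
Qed.

Definition optimal S f := proper_on S f && (#|f @: S| == chi S).

Lemma exists_optimal S : exists f, optimal S f.
Proof.
rewrite /optimal /chi; case: arg_minnP => [|g gP _]; first exact: id_coloring_proper.
by exists g; rewrite gP eqxx.
Qed.

Lemma chi_mono S S' : S \subset S' -> chi S <= chi S'.
Proof.
move=> /subsetP sS; have [f /andP[/proper_onP fP /eqP <-]] := exists_optimal S'.
apply: leq_trans (chi_le (f := f) _) (subset_leq_card (imsetS _ _)).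
  by apply/proper_onP => x y /sS xS /sS yS; apply: fP.
exact/subsetP.
Qed.

(** * Singleton color classes *)

Definition singles S f :=
  [set x in S | [forall y in S, (f y == f x) ==> (y == x)]].

Lemma singlesP S f x :
  reflect (x \in S /\ {in S, forall y, f y = f x -> y = x}) (x \in singles S f).
Proof.
rewrite inE; apply: (iffP andP) => -[xS h]; split=> //.
  by move=> y yS e; move/forall_inP: h => /(_ y yS); rewrite e eqxx => /eqP.
by apply/forall_inP => y yS; apply/implyP => /eqP /h ->.
Qed.

(** Sum over the color classes: a singleton class contributes one to each term on the right, any
    other class at least two to [#|S|]. *)
Lemma card_singles S f : 2 * #|f @: S| <= #|S| + #|singles S f|.
Proof.
have fS (A : {set G}) : A \subset S ->
    #|A| = \sum_(c in f @: S) #|[set x in A | f x == c]|.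
  move=> /subsetP sA; rewrite -sum1_card.
  rewrite (partition_big f [in f @: S]) /= => [|x /sA xS]; last first.
    exact: imset_f.
  by apply: eq_bigr => c _; rewrite -sum1_card; apply: eq_bigl => x; rewrite inE.
have sQ : singles S f \subset S by apply/subsetP => x /singlesP[].
rewrite (fS S) // (fS _ sQ) -big_split /= mulnC -sum_nat_const.
apply: leq_sum => c /imsetP[x xS ->].
have [xQ|] := boolP (x \in singles S f).
  by apply: (@leq_add 1 1); rewrite card_gt0; apply/set0Pn; exists x;
     rewrite inE eqxx andbT.
rewrite inE xS negb_forall_in /= => /exists_inP[y yS].
rewrite negb_imply => /andP[/eqP e nyx].
apply: leq_trans (leq_addr _ _).
have <- : #|[set y; x]| = 2 by rewrite cards2 nyx.
apply: subset_leq_card; apply/subsetP => v.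
by rewrite !inE => /orP[] /eqP ->; rewrite ?xS ?yS ?e eqxx.
Qed.

(** * Moving one vertex into another color class *)

Definition recolor f y (c : G) : {ffun G -> G} :=
  [ffun v => if v == y then c else f v].

Section Recolor.

Variables (S : {set G}) (f : {ffun G -> G}) (x y : G).
Hypothesis fO : optimal S f.
Hypotheses (xS : x \in S) (nxy : x != y).
Hypothesis y_free : {in S, forall v, v != y -> f v = f x -> ~~ adj y v}.

Lemma recolor_proper : proper_on S (recolor f y (f x)).
Proof.
have /andP[/proper_onP fP _] := fO.
apply/proper_onP => a b aS bS; rewrite !ffunE.
have [->|nay] := eqVneq a y; have [->|nby] := eqVneq b y.
- by rewrite adj_irr.
- by move=> yb /esym e; move: yb; rewrite (negPf (y_free bS nby e)).
- by rewrite adj_sym => ya e; move: ya; rewrite (negPf (y_free aS nay e)).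
- exact: fP.
Qed.

Lemma recolor_image : recolor f y (f x) @: S \subset f @: S.
Proof.
apply/subsetP => _ /imsetP[v vS ->]; rewrite ffunE.
by case: ifP => _; apply: imset_f.
Qed.

Lemma recolor_optimal : optimal S (recolor f y (f x)).
Proof.
have /andP[_ /eqP e] := fO.
rewrite /optimal recolor_proper eqn_leq chi_le ?recolor_proper // andbT -e.
exact: subset_leq_card recolor_image.
Qed.

(** If [y] were alone in its class, moving it into the class of [x] would free the color [f y],
    against optimality. *)
Lemma recolor_nonsingle : y \notin singles S f.
Proof.
apply/negP => /singlesP[yS h]; have /andP[_ /eqP e] := fO.
have := chi_le recolor_proper; rewrite -e leqNgt => /negP; apply.
apply: proper_card; rewrite properE recolor_image /=.
apply/subsetPn; exists (f y); first exact: imset_f.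
apply/imsetP => -[v vS]; rewrite ffunE; have [_|nvy] := eqVneq v y => e'.
  by move/eqP: nxy; apply; apply: h.
by move/eqP: nvy; apply; apply: h.
Qed.

End Recolor.

Lemma singles_adj S f x y :
  optimal S f -> x \in singles S f -> y \in singles S f -> x != y -> adj x y.
Proof.
move=> fO /singlesP[xS hx] yQ nxy; apply: contraLR yQ => nadj.
apply: (recolor_nonsingle fO xS nxy) => v vS _ /(hx _ vS) ->.
by rewrite adj_sym.
Qed.

(** Moving [y] into the singleton class of [x] either removes a singleton class
    or takes [y] out of a class [{y, z}], whose rest [z] replaces [x] among the
    singletons. *)
Lemma optimal_move S f x y (f' := recolor f y (f x)) :
    optimal S f -> x \in singles S f -> y \in S -> y != x -> ~~ adj x y ->
  [/\ optimal S f', singles S f :\ x \subset singles S f',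
      #|singles S f'| <= #|singles S f| &
      #|singles S f'| < #|singles S f| \/
      exists z, [/\ z \in S, z != y, f z = f y,
        {in S, forall v, f v = f y -> v = y \/ v = z} & z \in singles S f'
        /\ adj x z]].
Proof.
move=> fO xQ yS nyx nadj; have /singlesP[xS hx] := xQ.
have nxy : x != y by rewrite eq_sym.
have free : {in S, forall v, v != y -> f v = f x -> ~~ adj y v}.
  by move=> v vS _ /(hx _ vS) ->; rewrite adj_sym.
have f'O : optimal S f' := recolor_optimal fO xS free.
have yNQ := recolor_nonsingle fO xS nxy free.
have f'y : f' y = f x by rewrite ffunE eqxx.
have f'E v : v != y -> f' v = f v by rewrite ffunE => /negPf ->.
have sQ : singles S f :\ x \subset singles S f'.
  apply/subsetP => v /setD1P[nvx vQ]; have /singlesP[vS hv] := vQ.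
  have nvy : v != y by apply: contraNneq yNQ => <-.
  apply/singlesP; split=> // a aS; rewrite (f'E v) //.
  have [->|nay] := eqVneq a y; last by rewrite f'E //; apply: hv.
  by rewrite f'y => e; move/eqP: nvx; case; rewrite (hv x).
have f'Q v : v \in singles S f' -> v != x /\ v != y.
  move=> /singlesP[vS hv]; split; apply: contraTneq nyx => e; subst v.
    by rewrite (hv y) // ?eqxx // f'y f'E.
  by rewrite (hv x) // ?eqxx // f'y f'E.
have nx : #|singles S f :\ x| < #|singles S f| by rewrite (cardsD1 x (singles S f)) xQ.
move: (yNQ); rewrite inE yS negb_forall_in /= => /exists_inP[z zS].
rewrite negb_imply => /andP[/eqP fzy nzy].
(* A singleton class created by the move can only be what remains of the old class of [y]. *)
have Q'sub v : v \in singles S f' -> v \in singles S f :\ x \/ f v = f y.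
  move=> vQ'; have [nvx nvy] := f'Q _ vQ'; have /singlesP[vS hv] := vQ'.
  have [->|nfvy] := eqVneq (f v) (f y); [by right | left].
  rewrite !inE nvx vS; apply/forall_inP => a aS; apply/implyP => /eqP e.
  apply/eqP/hv => //; rewrite (f'E v) // f'E //.
  by apply: contraNneq nfvy => <-; rewrite e.
have nzx : z != x.
  apply: contraNneq nyx => ezx; rewrite (hx y) //; by rewrite -fzy ezx.
have [zQ'|zNQ'] := boolP (z \in singles S f'); last first.
  have lt : #|singles S f'| < #|singles S f|.
    apply: leq_ltn_trans nx; apply: subset_leq_card.
    apply/subsetP => v vQ'; case: (Q'sub v vQ') => // fv.
    have /singlesP[vS hv] := vQ'; have [_ nvy] := f'Q _ vQ'.
    case/negP: zNQ'; suff -> : z = v by [].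
    by apply: hv; rewrite // !f'E // fzy fv.
  by split=> //; [apply: ltnW | left].
have cls : {in S, forall v, f v = f y -> v = y \/ v = z}.
  move=> v vS fv; have [->|nvy] := eqVneq v y; [by left | right].
  by have /singlesP[_ hz] := zQ'; apply: hz; rewrite // !f'E // fzy fv.
(* Otherwise [z] could follow [y] into the class of [x], which would save a color. *)
have adjxz : adj x z.
  apply: contraLR zQ' => nxz.
  have xz : x != z by rewrite eq_sym.
  apply: (recolor_nonsingle (x := x) f'O xS xz) => v vS nvz.
  rewrite (f'E x) //; have [->|nvy] := eqVneq v y => [_|]; last first.
    by rewrite f'E // => /(hx _ vS) ->; rewrite adj_sym.
  have /andP[/proper_onP fP _] := fO.
  by apply/negP => zy; apply: (fP z y).
split=> //; last by right; exists z; split.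
apply: leq_trans nx; rewrite -[X in _ <= X]/(1 + #|singles S f :\ x|)%N.
rewrite -[1](cards1 z); apply: leq_trans (leq_card_setU _ _).
apply: subset_leq_card; apply/subsetP => v vQ'; rewrite inE in_set1.
case: (Q'sub v vQ') => [->|fv]; first by rewrite orbT.
have /singlesP[vS _] := vQ'; have [_ nvy] := f'Q _ vQ'.
by case: (cls v vS fv) nvy => ->; rewrite eqxx.
Qed.

(** * Colorings with fewest singletons, and vertex-critical sets *)

Definition thrifty S f :=
  optimal S f /\ forall g, optimal S g -> #|singles S f| <= #|singles S g|.

Lemma exists_thrifty S : exists f, thrifty S f.
Proof.
have [f0 f0O] := exists_optimal S.
case: (arg_minnP (fun f : {ffun G -> G} => #|singles S f|) f0O) => f fO fmin.
by exists f; split.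
Qed.

Definition critical S := forall w, w \in S -> chi (S :\ w) < chi S.

(** By criticality [S :\ w] needs fewer colors; giving [w] a fresh color then costs at most [chi S]
    in total. *)
Lemma critical_single S w :
  critical S -> w \in S -> exists2 f, optimal S f & w \in singles S f.
Proof.
move=> crit wS; have [g /andP[/proper_onP gP /eqP gc]] := exists_optimal (S :\ w).
have [c cN] : exists c, c \notin g @: (S :\ w).
  apply/existsP; rewrite -negb_forall; apply/negP => /forallP all.
  have : #|G| <= #|S :\ w|.
    rewrite -cardsT; apply: leq_trans (leq_imset_card g _).
    by apply: subset_leq_card; apply/subsetP => c _; apply: all.
  rewrite leqNgt -cardsT proper_card // properT.
  by apply/eqP => /setP/(_ w); rewrite !inE eqxx.
have gN v : v \in S -> v != w -> g v <> c.
  by move=> vS nvw e; move: cN; rewrite -e imset_f // !inE nvw.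
have fP : proper_on S (recolor g w c).
  apply/proper_onP => a b aS bS; rewrite !ffunE.
  have [->|na] := eqVneq a w; have [->|nb] := eqVneq b w.
  - by rewrite adj_irr.
  - by move=> _ /esym; apply: gN.
  - by move=> _; apply: gN.
  - by apply: gP; rewrite !inE ?na ?nb.
exists (recolor g w c).
  rewrite /optimal fP eqn_leq chi_le // andbT.
  apply: leq_trans (crit w wS); rewrite -gc.
  rewrite -[X in _ <= X]/(1 + #|g @: (S :\ w)|)%N -[1](cards1 c).
  apply: leq_trans (leq_card_setU _ _); apply: subset_leq_card.
  apply/subsetP => _ /imsetP[v vS ->]; rewrite ffunE inE in_set1.
  have [_|nv] := eqVneq v w; first by rewrite eqxx.
  by rewrite imset_f ?orbT // !inE nv.
apply/singlesP; split=> // v vS; rewrite !ffunE eqxx.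
by case: eqVneq => // nv /gN; case.
Qed.

(** A coloring [g] with [w] as a singleton, chosen as close to [f] as possible, could still be
    improved by reuniting two vertices that share a class of [f]. *)
Lemma thrifty_no_common_nonneighbor S f u v w :
    critical S -> thrifty S f -> u \in singles S f -> v \in singles S f ->
    u != v -> w \in S -> ~~ adj u w -> ~~ adj v w -> False.
Proof.
move=> crit [fO fmin] uQ vQ nuv wS nuw nvw.
have nwu : w != u.
  by apply: contraNneq nvw => ->; apply: singles_adj fO _ _ _; rewrite // eq_sym.
have nwv : w != v.
  by apply: contraNneq nuw => ->; apply: singles_adj fO _ _ _.
(* Among the optimal colorings [g] with singleton [w], minimize first the number
   of singletons, then the disagreement with [f]. *)
have [g0 g0O g0w] := critical_single crit wS.
pose Dis g := [set p : G * G |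
  [&& p.1 \in S, p.2 \in S, f p.1 == f p.2 & g p.1 != g p.2]].
(* [B] exceeds every disagreement count, so [m] compares lexicographically. *)
pose B := #|{: G * G}|.+1.
pose m g := (#|singles S g| * B + #|Dis g|)%N.
pose P g := optimal S g && (w \in singles S g).
have P0 : P g0 by rewrite /P g0O.
case: (arg_minnP m P0) => g /andP[gO wQ] gmin {g0 g0O g0w P0}.
have DisB h : #|Dis h| < B by rewrite ltnS max_card.
have out a : ~~ adj a w -> w != a -> a \notin singles S g.
  move=> naw nwa; apply: contra naw => aQ.
  by apply: singles_adj gO _ _ _; rewrite // eq_sym.
(* Being nonadjacent to [w], neither [u] nor [v] is a singleton of [g]. Since [f] has the fewest
   singletons, at least two singletons of [g] are not singletons of [f], and one of these differs
   from [w]. *)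
have [x xQ [nxw xNQ]] : exists2 x, x \in singles S g & x != w /\ x \notin singles S f.
  have c1 : 1 < #|singles S f :\: singles S g|.
    have <- : #|[set u; v]| = 2 by rewrite cards2 nuv.
    apply: subset_leq_card; apply/subsetP => a.
    by move=> /set2P[] ->; rewrite in_setD ?uQ ?vQ out.
  have c2 : #|singles S f :\: singles S g| <= #|singles S g :\: singles S f|.
    rewrite -(leq_add2l #|singles S f :&: singles S g|) cardsID.
    by rewrite setIC cardsID fmin.
  have : 0 < #|(singles S g :\: singles S f) :\ w|.
    have := leq_trans c1 c2; rewrite (cardsD1 w (_ :\: _)).
    by case: (w \in _) => //=; rewrite ?add1n // add0n; apply: ltnW.
  rewrite card_gt0 => /set0Pn[x]; rewrite in_setD1 in_setD => /and3P[? ? ?].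
  by exists x.
have /singlesP[xS _] := xQ.
move: (xNQ); rewrite inE xS negb_forall_in /= => /exists_inP[y yS].
rewrite negb_imply => /andP[/eqP fyx nyx].
have /andP[/proper_onP fP _] := fO.
have nadj : ~~ adj x y by apply/negP => xy; apply: (fP x y).
(* In [g], move [y] to its [f]-classmate [x]. As [x] is not [w], the vertex [w] stays a singleton,
   and each alternative of [optimal_move] lowers [m]. *)
have [g'O sQ leQ alt] := optimal_move gO xQ yS nyx nadj.
set g' := recolor g y (g x) in g'O sQ leQ alt.
have Pg' : P g' by rewrite /P g'O (subsetP sQ) // !in_setD1 wQ andbT eq_sym.
have := gmin g' Pg'; rewrite leqNgt => /negP; apply.
case: alt => [lt | [z [zS nzy gzy cls [zQ xz]]]].
  rewrite /m; apply: leq_trans (leq_addr _ _).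
  apply: (@leq_trans (#|singles S g'| * B + B)); first by rewrite ltn_add2l.
  by rewrite addnC -mulSn leq_mul2r lt orbT.
rewrite /m -addnS; apply: leq_add; first by rewrite leq_mul2r leQ orbT.
have g'E a : a != y -> g' a = g a by rewrite ffunE => /negPf ->.
have g'y : g' y = g x by rewrite ffunE eqxx.
(* The [g]-class of [y] is [{y, z}], and [z], adjacent to [x], is outside the [f]-class of [x] and
   [y]. So the move separates no pair joined by [f], and it reunites [x] with [y]. *)
have key b : b \in S -> f b = f y -> b != y -> g b <> g y.
  move=> bS fb nb gb; case: (cls b bS gb) => e; first by rewrite e eqxx in nb.
  by apply: (fP x z) => //; rewrite -e fb.
have xy1 : (x, y) \in Dis g.
  rewrite inE /= xS yS fyx eqxx; apply/eqP => e.
  by have /singlesP[_ /(_ y yS (esym e)) e'] := xQ; rewrite e' eqxx in nyx.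
apply: proper_card; apply/properP; split; last first.
  by exists (x, y) => //; rewrite inE /= g'y g'E ?eqxx ?andbF // eq_sym.
apply/subsetP => -[a b]; rewrite !inE /= => /and4P[aS bS /eqP fab g'ab].
rewrite aS bS fab eqxx /=; apply: contraNneq g'ab => gab.
have [ea|na] := eqVneq a y; have [eb|nb] := eqVneq b y.
- by rewrite ea eb.
- by subst a; case: (key b).
- by subst b; case: (key a).
- by rewrite !g'E // gab.
Qed.


(** * Cliques and independent sets *)

Lemma cliqueP (A : {set G}) :
  reflect {in A &, forall x y, x != y -> adj x y} (clique A).
Proof.
apply: (iffP forall_inP) => [h x y xA yA nxy | h x xA].
  by move/forall_inP: (h x xA) => /(_ y yA) /implyP; apply.
by apply/forall_inP => y yA; apply/implyP; apply: h.
Qed.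

Lemma independentP (A : {set G}) :
  reflect {in A &, forall x y, ~~ adj x y} (independent A).
Proof.
apply: (iffP forall_inP) => [h x y xA yA | h x xA].
  exact: (forall_inP (h x xA)).
by apply/forall_inP => y yA; apply: h.
Qed.

Lemma clique_number_ge (A : {set G}) : clique A -> #|A| <= clique_number G.
Proof. exact: (@leq_bigmax_cond _ _ (fun A : {set G} => #|A|)). Qed.

Lemma cliqueU1 (A : {set G}) v :
  clique A -> {in A, forall a, a != v -> adj v a} -> clique (v |: A).
Proof.
move=> /cliqueP cA vA; apply/cliqueP => x y /setU1P[->|xA] /setU1P[->|yA].
- by rewrite eqxx.
- by rewrite eq_sym; apply: vA.
- by rewrite adj_sym; apply: vA.
- exact: cA.
Qed.

Lemma singles_clique S f : optimal S f -> clique (singles S f).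
Proof. by move=> fO; apply/cliqueP => x y; apply: singles_adj fO. Qed.

(** * Partners of nonneighbors, and the cliques they form *)

Lemma thrifty_partner S f u w :
    thrifty S f -> u \in singles S f -> w \in S -> w != u -> ~~ adj u w ->
  exists z, [/\ z \in S, z != w, f z = f w,
    {in S, forall v, f v = f w -> v = w \/ v = z} &
    [/\ optimal S (recolor f w (f u)), z \in singles S (recolor f w (f u)),
        singles S f :\ u \subset singles S (recolor f w (f u)) & adj u z]].
Proof.
move=> [fO fmin] uQ wS nwu nadj.
have [gO sQ _ [|[z [? ? ? ? [? ?]]]]] := optimal_move fO uQ wS nwu nadj.
  by rewrite ltnNge fmin.
by exists z; split.
Qed.

(** A move does not raise the number of singletons, so a second move may follow the first. *)
Lemma thrifty_recolor S f u w :
    thrifty S f -> u \in singles S f -> w \in S -> w != u -> ~~ adj u w ->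
  thrifty S (recolor f w (f u)).
Proof.
move=> [fO fmin] uQ wS nwu nadj.
have [gO _ le _] := optimal_move fO uQ wS nwu nadj.
by split=> // g /fmin; apply: leq_trans.
Qed.

Lemma partner_notin_singles S f w z :
  w \in S -> z != w -> f z = f w -> z \notin singles S f.
Proof.
move=> wS nzw e; apply/singlesP => -[_ /(_ w wS (esym e)) /eqP].
by rewrite eq_sym (negPf nzw).
Qed.

Lemma clique_of_thrifty S f :
    critical S -> thrifty S f ->
    {in singles S f, forall u, exists2 w, w \in S & (w != u) && ~~ adj u w} ->
  2 * #|singles S f| <= clique_number G.
Proof.
move=> crit fT nonuniv; have [fO _] := fT.
(* The pair [q] is a nonneighbor of [u] with its classmate. The condition is vacuous outside
   [singles S f], so that pairs can be chosen for all vertices at once. *)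
pose partner u (q : G * G) := u \in singles S f ->
    [/\ q.1 \in S, q.1 != u, ~~ adj u q.1 &
    [/\ q.2 \in S, q.2 != q.1, f q.2 = f q.1,
    {in S, forall v, f v = f q.1 -> v = q.1 \/ v = q.2} &
    [/\ optimal S (recolor f q.1 (f u)),
        q.2 \in singles S (recolor f q.1 (f u)),
        singles S f :\ u \subset singles S (recolor f q.1 (f u))
      & adj u q.2]]].
have /fin_all_exists[p pP] : forall u, exists q, partner u q.
  move=> u; have [uQ|uNQ] := boolP (u \in singles S f); last first.
    by exists (u, u) => uQ; rewrite uQ in uNQ.
  have [w wS /andP[nwu nadj]] := nonuniv u uQ.
  by have [z zP] := thrifty_partner fT uQ wS nwu nadj; exists (w, z).
pose b u := (p u).2.
have wneq u v : u \in singles S f -> v \in singles S f -> u != v ->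
    (p u).1 != (p v).1.
  move=> uQ vQ nuv; have [uS _ nu _] := pP u uQ; have [_ _ nv _] := pP v vQ.
  apply/eqP => e; rewrite -e in nv.
  exact: (thrifty_no_common_nonneighbor crit fT uQ vQ nuv uS nu nv).
(* Moving the nonneighbor of [v] into the class of [v] makes [b v] a singleton and keeps [u] one. *)
have adjb u v : u \in singles S f -> v \in singles S f -> adj u (b v).
  move=> uQ vQ; have [_ _ _ [_ _ _ _ [gO bQ sQ a]]] := pP v vQ.
  have [->//|nuv] := eqVneq u v.
  have uQ' : u \in singles S (recolor f (p v).1 (f v)).
    by rewrite (subsetP sQ) // in_setD1 nuv.
  apply: singles_adj gO uQ' bQ _; apply: contraTneq uQ => ->.
  have [wS _ _ [_ nbw e _ _]] := pP v vQ.
  exact: partner_notin_singles wS nbw e.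
have wb u v : u \in singles S f -> v \in singles S f -> (p u).1 != b v.
  move=> uQ vQ; have [_ _ nu _] := pP u uQ.
  by apply: contraNneq nu => ->; apply: adjb.
have fw u v : u \in singles S f -> v \in singles S f -> u != v ->
    f (p u).1 <> f (p v).1.
  move=> uQ vQ nuv e; have [uS _ _ _] := pP u uQ.
  have [_ _ _ [_ _ _ cls _]] := pP v vQ.
  by case: (cls _ uS e) => /eqP; apply/negP; [apply: wneq | apply: wb].
have fb u : u \in singles S f -> f (b u) = f (p u).1.
  by move=> uQ; have [_ _ _ []] := pP u uQ.
have b_inj : {in singles S f &, injective b}.
  move=> u v uQ vQ e; apply/eqP; apply/negPn/negP => nuv.
  by apply: (fw u v uQ vQ nuv); rewrite -!fb // e.
(* After the moves for [u] and then for [v], both [b u] and [b v] are singletons of one optimal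
   coloring. *)
have bb u v : u \in singles S f -> v \in singles S f -> u != v ->
    adj (b u) (b v).
  move=> uQ vQ nuv; have [wS nwu nadj [_ nbu _ _ [gO bQ sQ _]]] := pP u uQ.
  set g := recolor f (p u).1 (f u) in gO bQ sQ.
  have gT : thrifty S g := thrifty_recolor fT uQ wS nwu nadj.
  have vQ' : v \in singles S g by rewrite (subsetP sQ) // in_setD1 eq_sym nuv.
  have [wS' nwv nadj' [bS nbw _ _ _]] := pP v vQ.
  have [z [zS nzw gz cls [hO zQ sQ' _]]] := thrifty_partner gT vQ' wS' nwv nadj'.
  have gE a : a != (p u).1 -> g a = f a by rewrite ffunE => /negPf ->.
  have gw : g (p v).1 = f (p v).1 by rewrite gE // wneq // eq_sym.
  have gb : g (b v) = g (p v).1 by rewrite gw gE ?fb // eq_sym wb.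
  have ebz : b v = z by case: (cls (b v) bS gb) => // /eqP; rewrite (negPf nbw).
  rewrite ebz; apply: singles_adj hO _ zQ _.
    rewrite (subsetP sQ') // in_setD1 bQ andbT.
    apply: contraTneq vQ => <-; exact: partner_notin_singles wS nbu (fb u uQ).
  by rewrite -ebz; apply: contraNneq nuv => /b_inj ->.
have /clique_number_ge : clique (singles S f :|: b @: singles S f).
  apply/cliqueP => x y /setUP[xQ|/imsetP[u uQ ->]] /setUP[yQ|/imsetP[v vQ ->]].
  - exact: singles_adj fO _ _.
  - by move=> _; apply: adjb.
  - by move=> _; rewrite adj_sym; apply: adjb.
  - by move=> nb; apply: bb => //; apply: contraNneq nb => ->.
apply: leq_trans; rewrite cardsU (card_in_imset b_inj).
suff -> : singles S f :&: b @: singles S f = set0.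
  by rewrite cards0 subn0 mul2n addnn.
apply/eqP; rewrite setI_eq0 disjoint_sym; apply/pred0P => x /=; apply/negP.
case/andP => /imsetP[u uQ ->]; apply/negP.
have [wS _ _ [_ nbw _ _ _]] := pP u uQ.
exact: partner_notin_singles wS nbw (fb u uQ).
Qed.

(** A vertex [w] of [S] outside the maximum clique of singletons has a nonneighbor in it; the
    classmate of [w] is then adjacent to the whole clique and would enlarge it. *)
Lemma max_singles_is_clique S f :
    thrifty S f -> #|singles S f| = clique_number G -> S = singles S f.
Proof.
move=> fT eQ; have [fO _] := fT.
have sQS : singles S f \subset S by apply/subsetP => x /singlesP[].
have cl := singles_clique fO.
have noext v : v \notin singles S f ->
    {in singles S f, forall a, adj v a} -> False.
  move=> vN vQ; have /clique_number_ge : clique (v |: singles S f).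
    by apply: cliqueU1 => // a aQ _; apply: vQ.
  by rewrite cardsU1 vN eQ add1n ltnn.
apply/eqP; rewrite eqEsubset sQS andbT; apply/subsetP => w wS.
apply/negPn/negP => wN; apply: (noext w wN) => u uQ.
rewrite adj_sym; apply/negPn/negP => nadj.
have nwu : w != u by apply: contraNneq wN => ->.
have [z [zS nzw fz _ [gO zQ sQ uz]]] := thrifty_partner fT uQ wS nwu nadj.
have zN := partner_notin_singles wS nzw fz.
apply: (noext z zN) => a aQ; rewrite adj_sym.
have [->//|nau] := eqVneq a u.
apply: singles_adj gO _ zQ _; first by rewrite (subsetP sQ) // in_setD1 nau.
by apply: contraNneq zN => <-.
Qed.

(** * Critical subsets, and splitting off an independent color class *)

Lemma exists_critical (J : {set G}) :
  exists K : {set G}, [/\ K \subset J, chi K = chi J & critical K].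
Proof.
pose P (K : {set G}) := (K \subset J) && (chi K == chi J).
have P0 : P J by rewrite /P subxx eqxx.
case: (arg_minnP (fun K : {set G} => #|K|) P0) => K /andP[sKJ /eqP cK] Kmin.
exists K; split=> // w wK; rewrite ltn_neqAle chi_mono ?subsetDl // andbT.
apply/eqP => e; have := Kmin (K :\ w).
rewrite /P (subset_trans (subsetDl _ _) sKJ) e cK eqxx => /(_ isT).
by rewrite (cardsD1 w K) wK ltnn.
Qed.

Lemma chromatic_number_independent (I : {set G}) :
  independent I -> chromatic_number G <= (chi (~: I)).+1.
Proof.
move=> /independentP Iind.
have [f /andP[/proper_onP fP /eqP fc]] := exists_optimal (~: I).
pose g x := if x \in I then None else Some (f x).
apply: (leq_trans (chromatic_number_le (f := g) _)).
  apply/proper_onP => x y _ _ xy; rewrite /g.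
  case: ifPn => xI; case: ifPn => yI //.
    by move: (Iind x y xI yI); rewrite xy.
  by case; apply: fP; rewrite ?inE.
have Some_inj : injective (@Some G) by move=> a b [].
rewrite -fc -(card_imset _ Some_inj) -add1n.
rewrite -[1](cards1 (None : option G)); apply: leq_trans (leq_card_setU _ _).
apply: subset_leq_card; apply/subsetP => _ /imsetP[x _ ->]; rewrite /g inE in_set1.
case: ifPn => // xI; apply/orP; right; do 2 apply: imset_f; by rewrite inE.
Qed.

Lemma degree_le x : degree x <= max_degree G.
Proof. exact: leq_bigmax. Qed.

(** * The case of a maximum clique [K] *)

Lemma chromatic_number_clique_pendant (I K : {set G}) :
    independent I -> {in ~: I, forall v, exists2 u, u \in I & adj v u} ->
    K \subset ~: I -> clique K -> 0 < #|K| -> #|K| = clique_number G ->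
    max_degree G <= #|K| -> 2 * #|~: I| < 3 * #|K| ->
  chromatic_number G <= #|K|.
Proof.
move=> /independentP Iind Imax sKI cK K0 eK Dle HK.
have KNI v : v \in K -> v \notin I by move=> /(subsetP sKI); rewrite inE.
(* With [#|K| - 1] neighbors in [K] and one in [I], the bound on the degree leaves [k] no further
   neighbor. *)
have out k : k \in K -> exists u, [/\ u \in I, adj k u &
    forall y, adj k y -> y \notin K -> y = u].
  move=> kK; have [u uI ku] := Imax k (subsetP sKI k kK).
  exists u; split=> // y ky yK; apply/eqP/negPn/negP => nyu.
  have : y |: (u |: K :\ k) \subset [set y | adj k y].
    apply/subsetP => a /setU1P[->|/setU1P[->|/setD1P[nak aK]]]; rewrite inE //.
    by apply: (cliqueP _ cK) => //; rewrite eq_sym.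
  move/subset_leq_card; rewrite leqNgt => /negP; apply.
  have uK : u \notin K by apply: contraL uI => /KNI.
  rewrite !cardsU1 !inE (negPf nyu) (negPf yK) (negPf uK) !andbF /=.
  apply: leq_ltn_trans (degree_le k) _; apply: leq_ltn_trans Dle _.
  by rewrite (cardsD1 k K) kK; lia.
have [k1 k1K] : exists k, k \in K by apply/set0Pn; rewrite -card_gt0.
have [u1 [u1I k1u1 k1out]] := out k1 k1K.
(* Otherwise [u1] would extend the maximum clique [K]. *)
have [k2 k2K k2u1] : exists2 k, k \in K & ~~ adj u1 k.
  apply/exists_inP; rewrite -negb_forall_in; apply/negP => /forall_inP all.
  have /clique_number_ge : clique (u1 |: K) by apply: cliqueU1 => // a /all.
  by rewrite cardsU1 (contraL (KNI u1) u1I) -eK add1n ltnn.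
have nk : k2 != k1 by apply: contraNneq k2u1 => ->; rewrite adj_sym.
(* Each color is named by a vertex of [K]: the set [I] gets [k1], except that
   [u1], the neighbor of [k1], gets [k2]; the rest [L] is not adjacent to [K] and
   is colored injectively by [K :\ k1 :\ k2]. *)
pose L := ~: I :\: K.
pose C := enum (K :\ k1 :\ k2).
have cC : size C = (#|K| - 2)%N.
  rewrite -cardE (cardsD1 k1 K) k1K (cardsD1 k2 (K :\ k1)) !inE nk k2K /=; lia.
(* By hypothesis [2 * #|L| < #|K|]; as [#|K|] is at least 2, this gives [#|L| <= #|K| - 2]. *)
have cL : #|L| <= size C.
  have : (#|~: I| = #|K| + #|L|)%N.
    rewrite -(cardsID K (~: I)); congr (_ + _)%N; apply: eq_card => x.
    by rewrite !inE andb_idl // => /KNI.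
  have : 1 < #|K| by rewrite (cardsD1 k1 K) k1K (cardsD1 k2 (K :\ k1)) !inE nk k2K.
  by rewrite cC; lia.
(* The default [k1] is never reached on [L], whose indices stay below [size C]. *)
pose h x := nth k1 C (index x (enum L)).
have hi x : x \in L -> index x (enum L) < size C.
  by move=> xL; apply: leq_trans cL; rewrite cardE index_mem mem_enum.
have hC x : x \in L -> h x \in K :\ k1 :\ k2.
  by move=> xL; rewrite -mem_enum mem_nth // hi.
have h_inj : {in L &, injective h}.
  move=> x y xL yL /eqP; rewrite nth_uniq ?enum_uniq ?hi // => /eqP e.
  by have := congr1 (nth x (enum L)) e; rewrite !nth_index ?mem_enum.
pose g x := if x \in K then x else if x \in I then (if x == u1 then k2 else k1)
            else h x.
have gK x : x \in K -> g x = x by rewrite /g => ->.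
have gI x : x \in I -> g x = if x == u1 then k2 else k1.
  by move=> xI; rewrite /g xI (negPf (contraL (KNI x) xI)).
have gL x : x \in L -> g x = h x.
  by rewrite !inE /g => /andP[/negPf -> /negPf ->].
have cases x : [\/ x \in K, x \in I | x \in L].
  rewrite !inE; case: (x \in K); case: (x \in I);
  by [constructor 1 | constructor 2 | constructor 3].
(* The color [k2] of [u1] is safe because [u1] and [k2] are nonadjacent; [k1] is safe on the rest of
   [I] because [u1] is the only neighbor of [k1] outside [K]. *)
have KI x y : x \in K -> y \in I -> adj x y -> g x <> g y.
  move=> xK yI xy; rewrite gK // gI //; have [ey|ny] := eqVneq y u1 => e.
    by move: k2u1; rewrite -e -ey adj_sym xy.
  by subst x; move/eqP: ny; case; apply: k1out => //; apply: contraL yI => /KNI.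
have KL x y : x \in K -> y \in L -> ~~ adj x y.
  move=> xK /setDP[]; rewrite inE => yI yK; apply/negP => xy.
  by have [u [uI _ /(_ y xy yK) e]] := out x xK; rewrite e uI in yI.
have IL x y : x \in I -> y \in L -> g x <> g y.
  move=> xI yL; rewrite gI // gL // => e; have := hC y yL; rewrite -e.
  by case: ifP => _; rewrite !inE eqxx ?andbF.
apply: (leq_trans (chromatic_number_le (f := g) _)).
  apply/proper_onP => x y _ _ xy.
  have nxy : x != y by apply: contraTneq xy => ->; rewrite adj_irr.
  have yx : adj y x by rewrite adj_sym.
  case: (cases x) => xM; case: (cases y) => yM.
  - by rewrite !gK //; apply/eqP.
  - exact: KI.
  - by case/negP: (KL x y xM yM).
  - by apply/nesym; apply: KI.
  - by case/negP: (Iind x y xM yM).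
  - exact: IL.
  - by case/negP: (KL y x yM xM).
  - by apply/nesym; apply: IL.
  - by rewrite !gL // => /h_inj e; move/eqP: nxy; apply; apply: e.
apply: subset_leq_card; apply/subsetP => _ /imsetP[x _ ->].
case: (cases x) => xM; first by rewrite gK.
  by rewrite gI //; case: ifP.
by rewrite gL //; have := hC x xM; rewrite !inE => /and3P[].
Qed.

(** * The dichotomy over the natural numbers *)

Lemma chromatic_dichotomy :
  2 * chromatic_number G <= clique_number G + max_degree G + 1 \/
  4 * chromatic_number G + 2 * independence_number G
    <= clique_number G + 2 * #|G| + 4.
Proof.
have [I /independentP Iind eI] :
    exists2 I : {set G}, independent I & #|I| = independence_number G.
  rewrite /independence_number.
  have i0 : independent (set0 : {set G}) by apply/independentP => x y; rewrite inE.
  have := @eq_bigmax_cond _ (fun A : {set G} => independent A) (fun A => #|A|).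
  case=> [|A iA ->]; last by exists A.
  by apply/card_gt0P; exists set0.
have Imax : {in ~: I, forall v, exists2 u, u \in I & adj v u}.
  move=> v; rewrite inE => vI.
  have [/exists_inP //|] := boolP [exists u in I, adj v u].
  rewrite negb_exists_in => /forall_inP nv.
  have : #|v |: I| <= independence_number G.
    apply: (@leq_bigmax_cond _ _ (fun A : {set G} => #|A|)).
    apply/independentP => x y /setU1P[->|xI] /setU1P[->|yI].
    - by rewrite adj_irr.
    - exact: nv.
    - by rewrite adj_sym; apply: nv.
    - exact: Iind.
  by rewrite cardsU1 vI eI add1n ltnn.
have /independentP/chromatic_number_independent chiG := Iind.
have cI : (#|G| = #|I| + #|~: I|)%N by rewrite cardsC.
have [K [sKI cK crit]] := exists_critical (~: I).
have lK := subset_leq_card sKI.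
have [f fT] := exists_thrifty K; have [fO _] := fT.
have nK := card_singles K f.
have /andP[_ /eqP cf] := fO; rewrite cf cK in nK.
have Qle := clique_number_ge (singles_clique fO).
have [/forall_inP nonuniv|] := boolP [forall u in singles K f,
    [exists w in K, (w != u) && ~~ adj u w]].
  (* Four times chi(G) is at most [2 * #|K| + 2 * #|Q| + 4], where Q is the set of singletons; here
     [2 * #|Q|] is at most omega and [#|K|] at most [#|G| - #|I|]. *)
  right; have := clique_of_thrifty crit fT (fun u uQ => exists_inP (nonuniv u uQ)).
  by lia.
rewrite negb_forall_in => /exists_inP[v /singlesP[vK _]].
rewrite negb_exists_in => /forall_inP univ.
have KD : #|K| <= max_degree G.
  apply: leq_trans (degree_le v); have [u uI vu] := Imax v (subsetP sKI v vK).
  rewrite (cardsD1 v K) vK.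
  have <- : #|u |: K :\ v| = (1 + #|K :\ v|)%N.
    have uK : u \notin K by apply: contraL uI => /(subsetP sKI); rewrite inE.
    by rewrite cardsU1 !inE (negPf uK) andbF.
  apply: subset_leq_card; apply/subsetP => a /setU1P[->|/setD1P[nav aK]].
    by rewrite inE.
  by have := univ a aK; rewrite nav negbK inE.
(* Twice chi(G) is at most [#|K| + #|Q| + 2], so one unit gained on [#|Q|] suffices. *)
have [lt|] := ltnP #|singles K f| (clique_number G); first by left; lia.
move=> ge; have eQ : #|singles K f| = clique_number G by lia.
have KQ := max_singles_is_clique fT eQ.
(* Now chi(G) is at most omega + 1. This yields (2) if [2 * #|~: I|] is at least 3 omega, and (1) if
   Delta exceeds omega. *)
have [HK|] := ltnP (2 * #|~: I|) (3 * #|K|); last by rewrite -KQ in eQ; right; lia.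
have [Dle|] := leqP (max_degree G) #|K|; last by rewrite -KQ in eQ nK; left; lia.
left; have : chromatic_number G <= #|K|.
  apply: chromatic_number_clique_pendant HK => //.
  - exact/independentP.
  - by rewrite KQ; apply: singles_clique.
  - by apply/card_gt0P; exists v.
  - by rewrite {1}KQ.
by rewrite -KQ in eQ nK; lia.
Qed.

End PartialColorings.

Local Open Scope ring_scope.

Theorem theorem3p3 (G : sgraph) :
  ((chromatic_number G)%:R
     <= ((clique_number G)%:R + (max_degree G)%:R + 1) / 2 :> rat)
  \/
  ((chromatic_number G)%:R
     <= ((clique_number G)%:R / 2 + #|G|%:R - (independence_number G)%:R) / 2
        + 1 :> rat).
Proof.
(* The integer form multiplies (1) by 2 and (2) by 4, with the independence number moved to the left
   to avoid truncated subtraction. *)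
have [|] := chromatic_dichotomy G; rewrite -(ler_nat rat) ?(natrM, natrD) => h.
  by left; lra.
by right; lra.
Qed.
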